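(* Let $u,v:(0,1)\to(0,\infty)$ be decreasing homeomorphisms (onto $(0,\infty)$) with $u(r)<\mu(r)<v(r)$ for all $r\in(0,1)$. Then for every $y>0$ and every $p\in\mathbb{Z}$, $$L\left(u^{-1}(2^{-p}y),-p\right)<\mu^{-1}(y)<L\left(v^{-1}(2^{-p}y),-p\right).$$
   Context: Landen sequences: for $r\in(0,1)$ put $L(r,0)=r$ and, for $p=0,1,2,\ldots$, define recursively $$L(r,p+1)=\frac{2\sqrt{L(r,p)}}{1+L(r,p)},\qquad L(r,-p-1)=\left(\frac{L(r,-p)}{1+\sqrt{1-L(r,-p)^2}}\right)^2 .$$ This defines $L(r,p)\in(0,1)$ for all $r\in(0,1)$ and $p\in\mathbb{Z}$. The complete elliptic integral is $\mathcal{K}(r)=\int_0^1\frac{dx}{\sqrt{(1-x^2)(1-r^2x^2)}}$ for $r\in(0,1)$. With $r'=\sqrt{1-r^2}$, the decreasing homeomorphism $\mu:(0,1)\to(0,\infty)$ is defined by $\mu(r)=\frac{\pi}{2}\frac{\mathcal{K}(r')}{\mathcal{K}(r)}$; $\mu^{-1}:(0,\infty)\to(0,1)$ denotes its inverse function. *)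

(* Defs.v *)
From HB Require Import structures.
From mathcomp Require Import all_boot all_order all_algebra.
From mathcomp Require Import all_classical all_reals all_analysis.

Set Implicit Arguments.
Unset Strict Implicit.
Unset Printing Implicit Defensive.

Import Order.TTheory GRing.Theory Num.Theory.
Import numFieldNormedType.Exports.

Local Open Scope classical_set_scope.
Local Open Scope ring_scope.

Section Landen.
Context {R : realType}.
Implicit Types (r : R) (n : nat) (p : int).

Definition landen_up r : R := 2 * Num.sqrt r / (1 + r).

Definition landen_down r : R := (r / (1 + Num.sqrt (1 - r ^+ 2))) ^+ 2.

(* [Negz n] is the integer - (n + 1). *)
Definition landen r p : R :=
  match p with
  | Posz n => iter n landen_up r
  | Negz n => iter n.+1 landen_down r
  end.

Lemma landen0 r : landen r 0 = r.
Proof. by []. Qed.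

Lemma landenS r n : landen r (n%:Z + 1) =
  2 * Num.sqrt (landen r n%:Z) / (1 + landen r n%:Z).
Proof. by rewrite -PoszD addn1. Qed.

Lemma landenB r n : landen r (- n%:Z - 1) =
  (landen r (- n%:Z) / (1 + Num.sqrt (1 - landen r (- n%:Z) ^+ 2))) ^+ 2.
Proof. by rewrite -opprD -PoszD addn1 -NegzE; case: n. Qed.

Definition ellipticK r : R :=
  \int[lebesgue_measure]_(x in `[0, 1])
    (Num.sqrt ((1 - x ^+ 2) * (1 - r ^+ 2 * x ^+ 2)))^-1.

Definition mu r : R :=
  pi / 2 * (ellipticK (Num.sqrt (1 - r ^+ 2)) / ellipticK r).

(* Inverse of [f], regarded as a map defined on the interval (0, 1); its value
   at [y] is meaningful only when [y] belongs to the image of (0, 1) by [f]. *)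
Definition inv01 (f : R -> R) : R -> R :=
  'pinv_(fun=> 0) (`]0, 1[ : set R) f.

(* Only the values of [f] on (0, 1) matter. *)
Definition decreasing_homeo (f : R -> R) : Prop :=
  [/\ set_bij `]0, 1[ `]0, +oo[ f,
      {in `]0, 1[ &, forall r s, r < s -> f s < f r},
      {within `]0, 1[, continuous f} &
      {within `]0, +oo[, continuous (inv01 f)}].

End Landen.

(* Main.v *)
Require Import Defs.
From mathcomp Require Import all_boot all_order all_algebra.
From mathcomp Require Import all_classical all_reals all_analysis.
From mathcomp Require Import measurable_realfun ring lra.
Import Order.TTheory GRing.Theory Num.Theory.
Import numFieldNormedType.Exports.
Local Open Scope classical_set_scope.
Local Open Scope ring_scope.

(** The theorem rests on one identity: the Landen step halves [mu], that is,
    [mu (landen r p) = 2 ^ (- p) * mu r] ([mu_landen]). It turns a bound for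
    [mu] at the point [landen r p] into one for [mu] at [r].

    Granting it, let [x] be the preimage of [y] under [mu], so that
    [z := landen x p] satisfies [mu z = 2 ^ (- p) * y]. The point [a] with
    [u a = 2 ^ (- p) * y] then satisfies [u z < mu z = u a], hence [a < z]
    because [u] decreases; likewise [z] is smaller than the point where [v]
    takes that value. Applying [landen _ (- p)], which is increasing and sends
    [z] back to [x], gives both inequalities.

    The identity reduces to Landen's transformation
    [K (2 sqrt r / (1 + r)) = (1 + r) * K r] ([ellipticK_landen_up]), obtained
    from the substitution [x = (1 + r) t / (1 + r t^2)] in the integral. It
    also governs the numerator of [mu], because [sqrt (1 - r^2)] is itself the
    ascending transform of [(1 - r) / (1 + r)], which is the modulus
    complementary to [2 sqrt r / (1 + r)].

    That [y] has a preimage at all ([mu_surj]) follows from the intermediate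
    value theorem: [mu] is continuous by dominated convergence, and the
    halving identity makes it arbitrarily small and arbitrarily large along a
    single Landen sequence. *)

(** * Algebra of the Landen maps *)

Section LandenMaps.
Context {R : realType}.
Implicit Types (r s : R) (n : nat) (p : int).

Lemma landen_up_itv r : 0 < r < 1 -> 0 < landen_up r < 1.
Proof.
move=> /andP[r0 r1]; rewrite /landen_up.
have q0 : 0 < Num.sqrt r by rewrite sqrtr_gt0.
have q1 : Num.sqrt r < 1 by rewrite -sqrtr1 ltr_sqrt.
rewrite -[X in 1 + X](sqr_sqrtr (ltW r0)).
move: (Num.sqrt r) q0 q1 => q q0 q1.
have ? : 0 < 1 + q ^+ 2 by nra.
by rewrite divr_gt0 ?mulr_gt0//= ltr_pdivrMr//; nra.
Qed.

Lemma landen_down_itv r : 0 < r < 1 -> 0 < landen_down r < 1.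
Proof.
move=> /andP[r0 r1]; rewrite /landen_down.
have q0 := sqrtr_ge0 (1 - r ^+ 2).
move: (Num.sqrt _) q0 => q q0.
have h : 0 < r / (1 + q) < 1.
  by rewrite divr_gt0 ?ltr_pdivrMr//=; lra.
by move: h => /andP[h0 h1]; rewrite exprn_gt0//= expr_lt1 // ltW.
Qed.

(** The radicand is a perfect square, so the modulus complementary to
    [landen_up r] is rational in [r]. *)
Lemma landen_up_compl r : 0 < r < 1 ->
  Num.sqrt (1 - landen_up r ^+ 2) = (1 - r) / (1 + r).
Proof.
move=> /andP[r0 r1].
have r1_neq0 : 1 + r != 0 by rewrite gt_eqF//; lra.
have -> : 1 - landen_up r ^+ 2 = ((1 - r) / (1 + r)) ^+ 2.
  rewrite /landen_up !expr_div_n exprMn (sqr_sqrtr (ltW r0)); field.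
  exact: r1_neq0.
by rewrite sqrtr_sqr ger0_norm// divr_ge0; lra.
Qed.

(** With [q = sqrt r] the up step is [2 q / (1 + q^2)], whose complementary
    modulus is [(1 - q^2) / (1 + q^2)]; the down step then gives [q ^ 2]. *)
Lemma landen_upK r : 0 < r < 1 -> landen_down (landen_up r) = r.
Proof.
move=> r01; rewrite /landen_down (landen_up_compl _ r01) /landen_up.
move: r01 => /andP[r0 r1].
have r1_neq0 : 1 + r != 0 by rewrite gt_eqF//; lra.
rewrite -[RHS](sqr_sqrtr (ltW r0)); congr (_ ^+ 2); field.
by rewrite r1_neq0/= gt_eqF//; lra.
Qed.

Lemma landen_downK r : 0 < r < 1 -> landen_up (landen_down r) = r.
Proof.
move=> /andP[r0 r1]; rewrite /landen_up /landen_down sqrtr_sqr.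
have q0 := sqrtr_ge0 (1 - r ^+ 2).
have : Num.sqrt (1 - r ^+ 2) ^+ 2 = 1 - r ^+ 2 by rewrite sqr_sqrtr//; nra.
move: (Num.sqrt _) q0 => q q0 qE.
rewrite ger0_norm ?divr_ge0//; [|lra..].
have rE : r ^+ 2 = 1 - q ^+ 2 by rewrite qE; ring.
rewrite expr_div_n rE; field.
by rewrite !gt_eqF//; nra.
Qed.

(** With [q = sqrt r] and [t = sqrt s], the difference of the two sides has
    the sign of [(t - q) * (1 - q * t)]. *)
Lemma landen_up_lt r s : 0 < r -> r < s -> s < 1 -> landen_up r < landen_up s.
Proof.
move=> r0 rs s1; rewrite /landen_up.
have s0 : 0 < s by exact: lt_trans rs.
have q0 : 0 < Num.sqrt r by rewrite sqrtr_gt0.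
have qt : Num.sqrt r < Num.sqrt s by rewrite ltr_sqrt.
have t1 : Num.sqrt s < 1 by rewrite -sqrtr1 ltr_sqrt.
rewrite -[X in _ / (1 + X) < _](sqr_sqrtr (ltW r0)).
rewrite -[X in _ < _ / (1 + X)](sqr_sqrtr (ltW s0)).
move: (Num.sqrt r) (Num.sqrt s) q0 qt t1 => q t q0 qt t1.
rewrite ltr_pdivrMr; last by nra.
rewrite mulrAC ltr_pdivlMr; last by nra.
have : 0 < (t - q) * (1 - q * t) by rewrite mulr_gt0//; nra.
by nra.
Qed.

(** The inverse of an increasing map is increasing. *)
Lemma landen_down_lt r s :
  0 < r -> r < s -> s < 1 -> landen_down r < landen_down s.
Proof.
move=> r0 rs s1.
have r01 : 0 < r < 1 by rewrite r0 (lt_trans rs).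
have s01 : 0 < s < 1 by rewrite s1 (lt_trans r0).
rewrite ltNge le_eqVlt; apply/negP => /orP[/eqP /(congr1 landen_up)|].
  by rewrite !landen_downK// => sr; move: rs; rewrite sr ltxx.
have /andP[ds0 _] := landen_down_itv _ s01.
have /andP[_ dr1] := landen_down_itv _ r01.
move=> /landen_up_lt => /(_ ds0 dr1).
by rewrite !landen_downK// => /(lt_trans rs); rewrite ltxx.
Qed.

Lemma landen_itv r p : 0 < r < 1 -> 0 < landen r p < 1.
Proof.
move=> r01; case: p => n /=.
  by elim: n => //= n; exact: landen_up_itv.
apply: landen_down_itv.
by elim: n => //= n; exact: landen_down_itv.
Qed.

Lemma landen_lt r s p : 0 < r -> r < s -> s < 1 -> landen r p < landen s p.
Proof.
move=> r0 rs s1.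
have r01 : 0 < r < 1 by rewrite r0 (lt_trans rs).
have s01 : 0 < s < 1 by rewrite s1 (lt_trans r0).
have up n : landen r n%:Z < landen s n%:Z.
  elim: n => //= n ih; have /andP[? _] := landen_itv _ n%:Z r01.
  by have /andP[_ ?] := landen_itv _ n%:Z s01; exact: landen_up_lt.
case: p => // n; elim: n => [|n ih] /=; first exact: landen_down_lt.
have /andP[? _] := landen_itv _ (Negz n) r01.
by have /andP[_ ?] := landen_itv _ (Negz n) s01; exact: landen_down_lt.
Qed.

Lemma landenK r p : 0 < r < 1 -> landen (landen r p) (- p) = r.
Proof.
move=> r01.
have iterK (f g : R -> R) n :
    (forall s, 0 < s < 1 -> 0 < f s < 1) ->
    (forall s, 0 < s < 1 -> g (f s) = s) ->
    iter n g (iter n f r) = r.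
  move=> f01 fK.
  have it01 m : 0 < iter m f r < 1 by elim: m => //= m; exact: f01.
  by elim: n => // n ih; rewrite iterSr iterS fK.
case: p => [[//|n]|n].
  exact: (iterK _ _ n.+1 landen_up_itv landen_upK).
exact: (iterK _ _ n.+1 landen_down_itv landen_downK).
Qed.

End LandenMaps.

(** * The complete elliptic integral *)

Section EllipticIntegral.
Context {R : realType}.
Implicit Types (r x : R) (n : nat).

Local Notation leb := (@lebesgue_measure R).

(** Legendre's normal form of the elliptic integrand. *)
Definition legendre r x : R :=
  (Num.sqrt ((1 - x ^+ 2) * (1 - r ^+ 2 * x ^+ 2)))^-1.

Lemma legendre_ge0 r x : 0 <= legendre r x.
Proof. by rewrite invr_ge0 sqrtr_ge0. Qed.

(** The inverse of [0] is [0], so the integrand vanishes at its singularity;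
    continuity in the modulus and domination thus hold up to [x = 1]. *)
Lemma legendre1 r : legendre r 1 = 0.
Proof. by rewrite /legendre expr1n subrr mul0r sqrtr0 invr0. Qed.

Lemma legendre_radicand_gt0 r x : 0 <= r < 1 -> -1 < x < 1 ->
  0 < (1 - x ^+ 2) * (1 - r ^+ 2 * x ^+ 2).
Proof.
move=> /andP[r0 r1] /andP[xN1 x1].
have x2 : x ^+ 2 < 1 by nra.
have r2 : r ^+ 2 < 1 by nra.
have : 0 <= x ^+ 2 by rewrite sqr_ge0.
by move=> ?; rewrite mulr_gt0 //; nra.
Qed.

Lemma legendre_ge1 r x : 0 <= r < 1 -> 0 <= x < 1 -> 1 <= legendre r x.
Proof.
move=> r01 /andP[x0 x1].
have x11 : -1 < x < 1 by apply/andP; split; lra.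
have radicand_gt0 := legendre_radicand_gt0 _ _ r01 x11.
rewrite invf_ge1 ?sqrtr_gt0// -[leRHS]sqrtr1 ler_wsqrtr//.
move/andP : r01 => [r0 r1].
have ? : 0 <= x ^+ 2 <= 1 by rewrite sqr_ge0/=; nra.
have ? : 0 <= r ^+ 2 * x ^+ 2 <= 1.
  rewrite -exprMn sqr_ge0/=; have ? : 0 <= r * x by rewrite mulr_ge0.
  have ? : r * x <= 1 by nra.
  by nra.
by apply: mulr_ile1; lra.
Qed.

Lemma continuous_legendre r x : 0 <= r < 1 -> -1 < x < 1 ->
  {for x, continuous (legendre r)}.
Proof.
move=> r01 x11; apply: cvgV.
  by rewrite gt_eqF// sqrtr_gt0 legendre_radicand_gt0.
apply: (@cvg_comp _ _ _ _ Num.sqrt); last exact: sqrt_continuous.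
apply: cvgM; apply: cvgB; first exact: cvg_cst.
- exact: exprn_continuous.
- exact: cvg_cst.
- by apply: cvgM; [exact: cvg_cst|exact: exprn_continuous].
Qed.

Lemma continuous_legendre_modulus r x : 0 <= r < 1 -> 0 <= x <= 1 ->
  {for r, continuous (legendre ^~ x)}.
Proof.
move=> r01 /andP[x0]; rewrite le_eqVlt => /predU1P[->|x1].
  rewrite /prop_for /continuous_at legendre1.
  by under eq_fun do rewrite legendre1; exact: cvg_cst.
apply: cvgV.
  by rewrite gt_eqF// sqrtr_gt0 legendre_radicand_gt0// x1 andbT; lra.
apply: (@cvg_comp _ _ _ _ Num.sqrt); last exact: sqrt_continuous.
apply: cvgM; first exact: cvg_cst.
apply: cvgB; first exact: cvg_cst.
by apply: cvgM; [exact: exprn_continuous|exact: cvg_cst].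
Qed.

Lemma measurable_legendre r : 0 <= r < 1 ->
  measurable_fun (`[0, 1] : set R) (legendre r).
Proof.
move=> r01; apply/measurable_fun_itv_bndo_bndcP.
apply/measurable_fun_itv_obnd_cbndP.
apply: open_continuous_measurable_fun => [|x]; first exact: interval_open.
rewrite inE/= in_itv/= => /andP[x0 x1]; apply: continuous_legendre => //.
by rewrite x1 andbT; lra.
Qed.

(** The elliptic integrand is unbounded near [1], whereas integration by
    primitives or by substitution asks for continuity on a closed interval:
    such computations are made on the intervals from [0] to [c n] and passed
    to the limit by monotone convergence. *)
Lemma ge0_integral_itv_cvg (f : R -> R) (c : nat -> R) :
  nondecreasing_seq c -> (forall n, c n < 1) -> c @ \oo --> (1 : R) ->
  measurable_fun (`[0, 1] : set R) f -> (forall x, 0 <= f x) ->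
  (\int[leb]_(x in `[0%R, c n]) (f x)%:E @[n --> \oo] -->
   \int[leb]_(x in `[0%R, 1%R]) (f x)%:E)%E.
Proof.
move=> c_nd c1 cvg_c mf f0.
have -> : (\int[leb]_(x in `[0%R, 1%R]) (f x)%:E =
           \int[leb]_(x in \bigcup_n `[0%R, c n]%classic) (f x)%:E)%E.
  rewrite -integral_itv_bndo_bndc; last first.
    by apply/measurable_EFinP; exact/measurable_fun_itv_bndo_bndcP.
  congr (integral _ _ _); apply/seteqP; split => x /=.
    rewrite in_itv/= => /andP[x0 x1].
    have [n _ /(_ _ (leqnn n)) xc] := cvgr_gt _ cvg_c _ x1.
    by exists n => //=; rewrite in_itv/= x0 ltW.
  by move=> [n _]; rewrite /= !in_itv/= => /andP[-> /le_lt_trans]; exact.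
apply: ge0_nondecreasing_set_cvg_integral => //=.
- move=> m n mn; rewrite subsetEset => x /=; rewrite !in_itv/=.
  by move=> /andP[-> /le_trans]; apply; exact: c_nd.
- move=> n; apply/measurable_EFinP; apply: measurable_funS mf => //=.
  by apply: subset_itvl; rewrite bnd_simp ltW.
- by move=> n x _; rewrite lee_fin.
Qed.

(** The shift by 2 keeps every endpoint positive. *)
Definition exhaustion n : R := 1 - n.+2%:R^-1.

Lemma exhaustion_itv n : 0 < exhaustion n < 1.
Proof.
rewrite /exhaustion subr_gt0 invf_lt1// ltr1n/=.
by rewrite ltrBlDr ltrDl invr_gt0.
Qed.

Lemma exhaustion_nd : nondecreasing_seq exhaustion.
Proof.
by move=> m n mn; rewrite lerD2l lerN2 lef_pV2 ?posrE// ler_nat !ltnS.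
Qed.

Lemma exhaustion_cvg : exhaustion @ \oo --> (1 : R).
Proof.
rewrite -[X in _ --> X]subr0; apply: cvgB; first exact: cvg_cst.
have := @cvg_harmonic R; rewrite -(cvg_shiftn 1); apply: cvg_trans.
by apply: near_eq_cvg; near=> n; rewrite /= addn1.
Unshelve. all: by end_near. Qed.

Lemma legendre0E x : legendre 0 x = (Num.sqrt (1 - x ^+ 2))^-1.
Proof. by rewrite /legendre expr0n/= mul0r subr0 mulr1. Qed.

Lemma integral_legendre0 (c : R) : 0 < c < 1 ->
  (\int[leb]_(x in `[0%R, c]) (legendre 0 x)%:E = (asin c)%:E)%E.
Proof.
move=> /andP[c0 c1].
have in11 x : 0 <= x <= c -> -1 < x < 1.
  by move=> /andP[? ?]; apply/andP; split; lra.
rewrite (@continuous_FTC2 _ _ (@asin R))//.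
- suff -> : asin 0 = 0 :> R by rewrite sube0.
  rewrite -[X in asin X]sin0 sinK// in_itv/=.
  by have := @pi_ge0 R; lra.
- apply: continuous_in_subspaceT => x; rewrite inE/= in_itv/= => xc.
  by apply: continuous_legendre; rewrite ?lexx ?ltr01//; exact: in11.
- split.
  + move=> x; rewrite in_itv/= => /andP[x0 xc].
    by have [] := @is_derive1_asin R x (in11 x _); rewrite ?ltW.
  + by apply/cvg_at_right_filter/continuous_asin/in11; rewrite lexx ltW.
  + by apply/cvg_at_left_filter/continuous_asin/in11; rewrite lexx ltW.
- move=> x; rewrite in_itv/= => /andP[x0 xc]; rewrite derive1E legendre0E.
  by apply: derive_val; apply: is_derive1_asin; apply: in11; rewrite !ltW.
Qed.

(** The integrals over the exhausting intervals are values of [asin], hence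
    at most [pi / 2]. *)
Lemma integrable_legendre0 :
  leb.-integrable (`[0, 1] : set R) (EFin \o legendre 0).
Proof.
have m0 : measurable_fun (`[0, 1] : set R) (legendre 0).
  by apply: measurable_legendre; rewrite lexx ltr01.
apply/integrableP; split; first exact/measurable_EFinP.
under eq_integral do rewrite /= ger0_norm ?legendre_ge0//.
have lt1 n : exhaustion n < 1 by have /andP[] := exhaustion_itv n.
have cvg0 := ge0_integral_itv_cvg _ _ exhaustion_nd lt1 exhaustion_cvg m0
  (legendre_ge0 0).
rewrite (@le_lt_trans _ _ (pi / 2)%:E) ?ltry//.
apply: cvge_le cvg0; apply: nearW => n.
have /andP[n0 n1] := exhaustion_itv n.
by rewrite integral_legendre0 ?n0// lee_fin asin_lepi2// ltW ?andbT//; lra.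
Qed.

(** Since [1 - r^2 x^2 >= 1 - b^2], the integrands of all moduli up to [b] are
    dominated by a multiple of [(1 - x^2)^(-1/2)]. *)
Lemma legendre_le r b x : 0 <= r <= b -> b < 1 -> 0 <= x <= 1 ->
  legendre r x <= (Num.sqrt (1 - b ^+ 2))^-1 * legendre 0 x.
Proof.
move=> /andP[r0 rb] b1 /andP[x0].
rewrite le_eqVlt => /predU1P[->|x1]; first by rewrite !legendre1 mulr0.
have x2 : 0 < 1 - x ^+ 2 by nra.
have b2 : 0 < 1 - b ^+ 2 by nra.
have rx : r * x <= b by nra.
have rx0 : 0 <= r * x by nra.
have le_br : 1 - b ^+ 2 <= 1 - r ^+ 2 * x ^+ 2 by rewrite -exprMn; nra.
rewrite legendre0E -invfM -sqrtrM ?(ltW b2)// /legendre.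
rewrite lef_pV2 ?posrE ?sqrtr_gt0 ?mulr_gt0//; last exact: lt_le_trans le_br.
by rewrite ler_wsqrtr// mulrC ler_pM2l.
Qed.

Lemma integrable_dominating (b : R) : leb.-integrable (`[0, 1] : set R)
  (EFin \o (fun x => (Num.sqrt (1 - b ^+ 2))^-1 * legendre 0 x)).
Proof.
have := integrableZl _ (Num.sqrt (1 - b ^+ 2))^-1 integrable_legendre0.
by apply; exact: measurable_itv.
Qed.

Lemma integrable_legendre r : 0 <= r < 1 ->
  leb.-integrable (`[0, 1] : set R) (EFin \o legendre r).
Proof.
move=> r01; have /andP[r0 r1] := r01.
apply: le_integrable (integrable_dominating r) => //=.
  by apply/measurable_EFinP; exact: measurable_legendre.
move=> x; rewrite in_itv/= => x01; rewrite lee_fin.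
rewrite ger0_norm ?legendre_ge0//; apply: le_trans (ler_norm _).
by apply: legendre_le; rewrite ?r0/=.
Qed.

Lemma ellipticK_fin r : 0 <= r < 1 ->
  (\int[leb]_(x in `[0%R, 1%R]) (legendre r x)%:E)%E = (ellipticK r)%:E.
Proof.
move=> r01; rewrite /ellipticK /Rintegral fineK//.
exact/integrable_fin_num/integrable_legendre.
Qed.

Lemma ellipticK_gt0 r : 0 <= r < 1 -> 0 < ellipticK r.
Proof.
move=> r01; rewrite -lte_fin -(ellipticK_fin _ r01).
have mr := measurable_legendre _ r01.
rewrite -integral_itv_bndo_bndc; last first.
  by apply/measurable_EFinP; exact/measurable_fun_itv_bndo_bndcP.
apply: (@lt_le_trans _ _ (\int[leb]_(x in `[0%R, 1%R[) (1%:E))%E).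
  by rewrite integral_cst//= lebesgue_measure_itv/= lte_fin ltr01 sube0 mul1e.
apply: ge0_le_integral => //=.
  by apply/measurable_EFinP; exact/measurable_fun_itv_bndo_bndcP.
by move=> x; rewrite in_itv/= lee_fin; exact: legendre_ge1.
Qed.

(** Dominated convergence on a neighbourhood [0 < s < b] of [r]: any [b]
    between [r] and [1] gives an integrable bound uniform in [s]. *)
Lemma continuous_ellipticK r : 0 < r < 1 -> {for r, continuous (@ellipticK R)}.
Proof.
move=> /andP[r0 r1]; pose b := (r + 1) / 2.
have [rb b1] : r < b /\ b < 1 by rewrite /b; split; lra.
have in01 s : `]0, b[%classic s -> 0 <= s < 1 /\ 0 <= s <= b.
  rewrite /= in_itv/= => /andP[s0 sb].
  by rewrite (ltW s0) (ltW sb) (lt_trans sb).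
apply: (@continuity_under_integral R _ _ leb legendre `[0, 1] _ 0 b _ _ _
  (integrable_dominating b) _ r) => //.
- by move=> s /in01[/integrable_legendre].
- apply: aeW => x; rewrite /= in_itv/= => x01 s; rewrite inE => /in01[s01 _].
  exact: continuous_legendre_modulus.
- move=> s /in01[_ sb]; apply: aeW => x; rewrite /= in_itv/= => x01.
  by rewrite ger0_norm ?legendre_ge0// legendre_le.
- by rewrite inE/= in_itv/= r0.
Qed.

End EllipticIntegral.

(** * Landen's transformation *)

Section LandenTransformation.
Context {R : realType}.
Implicit Types (r s t : R) (n : nat).

Local Notation leb := (@lebesgue_measure R).

(** Landen's change of variable: for [0 <= r < 1] it increases from [0] to [1]
    on the unit interval. *)
Definition landen_subst r t : R := (1 + r) * t / (1 + r * t ^+ 2).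

Definition landen_subst' r t : R :=
  (1 + r) * (1 - r * t ^+ 2) / (1 + r * t ^+ 2) ^+ 2.

Lemma landen_subst_denom_gt0 r t : 0 <= r -> 0 < 1 + r * t ^+ 2.
Proof. by move=> r0; rewrite ltr_wpDr// mulr_ge0// sqr_ge0. Qed.

Lemma is_derive_landen_subst r t : 0 <= r ->
  is_derive t 1 (landen_subst r) (landen_subst' r t).
Proof.
move=> r0.
have d0 : 1 + r * t ^+ 2 != 0 by rewrite gt_eqF// landen_subst_denom_gt0.
rewrite /landen_subst; apply: is_derive_eq.
rewrite /landen_subst' /GRing.scale/=; field.
by rewrite d0.
Qed.

Lemma continuous_landen_subst r : 0 <= r -> continuous (landen_subst r).
Proof.
move=> r0 t; have [/derivable1_diffP + _] := is_derive_landen_subst r t r0.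
exact: differentiable_continuous.
Qed.

Lemma continuous_landen_subst' r : 0 <= r -> continuous (landen_subst' r).
Proof.
move=> r0 t.
have cden : {for t, continuous (fun t => 1 + r * t ^+ 2)}.
  apply: cvgD; first exact: cvg_cst.
  by apply: cvgM; [exact: cvg_cst|exact: exprn_continuous].
apply: cvgM.
  apply: cvgM; first exact: cvg_cst.
  apply: cvgB; first exact: cvg_cst.
  by apply: cvgM; [exact: cvg_cst|exact: exprn_continuous].
apply: cvgV; first by rewrite expf_neq0// gt_eqF// landen_subst_denom_gt0.
apply: (@cvg_comp _ _ _ _ (fun x => x ^+ 2)); first exact: cden.
exact: exprn_continuous.
Qed.

(** The difference of the two sides has the sign of [(t - s) (1 - r s t)]. *)
Lemma landen_subst_lt r s t : 0 <= r < 1 -> 0 <= s -> s < t -> t <= 1 ->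
  landen_subst r s < landen_subst r t.
Proof.
move=> /andP[r0 r1] s0 st t1.
rewrite /landen_subst ltr_pdivrMr ?landen_subst_denom_gt0//.
rewrite mulrAC ltr_pdivlMr ?landen_subst_denom_gt0//.
have st1 : s * t < 1 by nra.
have rst1 : r * (s * t) < 1 by nra.
have : 0 < (1 + r) * ((t - s) * (1 - r * (s * t))).
  by rewrite !mulr_gt0 ?subr_gt0//; lra.
by nra.
Qed.

Lemma landen_subst0 r : landen_subst r 0 = 0.
Proof. by rewrite /landen_subst mulr0 mul0r. Qed.

Lemma landen_subst1 r : 0 <= r -> landen_subst r 1 = 1.
Proof.
by move=> r0; rewrite /landen_subst expr1n !mulr1 divff// gt_eqF//; lra.
Qed.

(** With [s = landen_up r] and [x] the image of [t], both factors of the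
    radicand simplify, because
    [(1 + r t^2)^2 - (1 + r)^2 t^2 = (1 - t^2) (1 - r^2 t^2)] and
    [(1 + r t^2)^2 - 4 r t^2 = (1 - r t^2)^2], and the second square cancels
    the derivative of the substitution up to [1 + r]. *)
Lemma legendre_landen_subst r t : 0 <= r < 1 -> 0 <= t < 1 ->
  legendre (landen_up r) (landen_subst r t) * landen_subst' r t =
  (1 + r) * legendre r t.
Proof.
move=> r01 /andP[t0 t1]; have /andP[r0 r1] := r01.
have t11 : -1 < t < 1 by apply/andP; split; lra.
have t2 : t ^+ 2 < 1 by nra.
have rt1 : 0 < 1 - r * t ^+ 2 by have := sqr_ge0 t; nra.
have d_gt0 := landen_subst_denom_gt0 r t r0.
have r1_neq0 : 1 + r != 0 by rewrite gt_eqF//; lra.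
have radicandE : (1 - landen_subst r t ^+ 2) *
    (1 - landen_up r ^+ 2 * landen_subst r t ^+ 2) =
    ((1 - r * t ^+ 2) / (1 + r * t ^+ 2) ^+ 2) ^+ 2 *
    ((1 - t ^+ 2) * (1 - r ^+ 2 * t ^+ 2)).
  rewrite /landen_up /landen_subst !expr_div_n !exprMn sqr_sqrtr//; field.
  by rewrite r1_neq0 gt_eqF.
rewrite /legendre radicandE sqrtrM ?sqr_ge0// sqrtr_sqr.
rewrite ger0_norm ?divr_ge0 ?sqr_ge0 ?ltW// /landen_subst'; field.
rewrite !gt_eqF// ?sqrtr_gt0 ?legendre_radicand_gt0//.
Qed.

Lemma integral_landen_subst r (c : R) : 0 < r < 1 -> 0 < c < 1 ->
  (\int[leb]_(x in `[0%R, landen_subst r c]) (legendre (landen_up r) x)%:E =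
   (1 + r)%:E * \int[leb]_(x in `[0%R, c]) (legendre r x)%:E)%E.
Proof.
move=> r01 /andP[c0 c1]; have /andP[/ltW r0 r1] := r01.
have r01' : 0 <= r < 1 by rewrite r0.
have /andP[/ltW s0 s1] := landen_up_itv _ r01.
have derE : derive1 (landen_subst r) = landen_subst' r.
  apply/funext => t; rewrite derive1E.
  by apply: derive_val; exact: is_derive_landen_subst.
have cF := continuous_landen_subst r r0.
have cF' := continuous_landen_subst' r r0.
have Fc1 : landen_subst r c < 1.
  by rewrite -[ltRHS](landen_subst1 _ r0) landen_subst_lt// ltW.
rewrite -[X in `[X, _]](landen_subst0 r).
rewrite (integration_by_substitution_increasing (ltW c0)).
- rewrite -ge0_integralZl_EFin//=.
  + apply: eq_integral => t; rewrite inE/= in_itv/= => /andP[t0 tc].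
    rewrite derE -EFinM; congr EFin.
    by apply: legendre_landen_subst; rewrite ?t0 ?(le_lt_trans tc).
  + by move=> x _; rewrite lee_fin legendre_ge0.
  + apply/measurable_EFinP; apply: measurable_funS (measurable_legendre _ r01').
      by [].
    by apply: subset_itvl; rewrite bnd_simp ltW.
  + by lra.
- move=> s t; rewrite !in_itv/= => /andP[sc _] /andP[_ tc] st.
  by rewrite landen_subst_lt// (le_trans tc)// ltW.
- by rewrite derE => t _; exact: cF'.
- by rewrite derE; apply: cvgP; apply: cvg_at_right_filter; exact: cF'.
- by rewrite derE; apply: cvgP; apply: cvg_at_left_filter; exact: cF'.
- split.
  + by move=> t _; have [] := is_derive_landen_subst r t r0.
  + by apply: cvg_at_right_filter; exact: cF.
  + by apply: cvg_at_left_filter; exact: cF.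
- apply: continuous_in_subspaceT => x; rewrite landen_subst0 inE/= in_itv/=.
  move=> /andP[x0 xc]; apply: continuous_legendre; rewrite ?s0//.
  by apply/andP; split; lra.
Qed.

(** The images of the exhausting intervals under the substitution exhaust the
    unit interval as well, so [integral_landen_subst] passes to the limit on
    both sides. *)
Lemma ellipticK_landen_up r : 0 < r < 1 ->
  ellipticK (landen_up r) = (1 + r) * ellipticK r.
Proof.
move=> r01; have /andP[/ltW r0 r1] := r01.
have r01' : 0 <= r < 1 by rewrite r0.
have /andP[/ltW s0 s1] := landen_up_itv _ r01.
have s01' : 0 <= landen_up r < 1 by rewrite s0.
have c01 := @exhaustion_itv R.
have c_lt1 n : exhaustion n < 1 :> R by have /andP[] := c01 n.
apply: EFin_inj; rewrite EFinM -!ellipticK_fin//.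
have cvg_r := ge0_integral_itv_cvg _ _ exhaustion_nd c_lt1 exhaustion_cvg
  (measurable_legendre _ r01') (legendre_ge0 r).
have cvg_s : (\int[leb]_(x in `[0%R, landen_subst r (exhaustion n)])
    (legendre (landen_up r) x)%:E @[n --> \oo] -->
    \int[leb]_(x in `[0%R, 1%R]) (legendre (landen_up r) x)%:E)%E.
  apply: (ge0_integral_itv_cvg _ (landen_subst r \o exhaustion)) => //.
  - move=> m n /(@exhaustion_nd R); rewrite le_eqVlt => /predU1P[/= ->//|lt_mn].
    have /andP[m0 _] := c01 m.
    by rewrite ltW// landen_subst_lt// ltW.
  - move=> n; rewrite -[ltRHS](landen_subst1 _ r0).
    by have /andP[n0 n1] := c01 n; rewrite landen_subst_lt// ltW.
  - rewrite -[X in _ --> X](landen_subst1 _ r0).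
    by apply: cvg_comp exhaustion_cvg _; exact: continuous_landen_subst.
  - exact: measurable_legendre.
  - exact: legendre_ge0.
apply: (cvg_unique _ cvg_s) => //.
rewrite /=; under eq_fun do rewrite integral_landen_subst//.
by apply: cvgeZl.
Qed.

(** Landen's transformation is used twice: at [r] for the denominator of [mu]
    and at [t = (1 - r) / (1 + r)] for its numerator. The factors [1 + r] and
    [1 + t = 2 / (1 + r)] leave exactly one half. *)
Lemma mu_landen_up r : 0 < r < 1 -> mu (landen_up r) = mu r / 2.
Proof.
move=> r01; have /andP[r0 r1] := r01.
have r1_neq0 : 1 + r != 0 by rewrite gt_eqF//; lra.
pose t := (1 - r) / (1 + r).
have t01 : 0 < t < 1.
  by rewrite /t divr_gt0 ?ltr_pdivrMr//=; lra.
have tE : landen_up t = Num.sqrt (1 - r ^+ 2).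
  have /andP[up0 _] := landen_up_itv _ t01.
  rewrite -[LHS]ger0_norm ?(ltW up0)// -sqrtr_sqr; congr Num.sqrt.
  rewrite /landen_up expr_div_n exprMn sqr_sqrtr; last first.
    by case/andP : t01 => /ltW.
  by rewrite /t; field; rewrite r1_neq0/= gt_eqF//; lra.
have K0 : ellipticK r != 0 by rewrite gt_eqF// ellipticK_gt0// r1 ltW.
rewrite /mu (landen_up_compl _ r01) -/t ellipticK_landen_up//.
rewrite -tE ellipticK_landen_up// /t; field.
by rewrite K0 r1_neq0.
Qed.

Lemma mu_landen r p : 0 < r < 1 -> mu (landen r p) = 2 ^ (- p) * mu r.
Proof.
move=> r01; case: p => n.
  elim: n => [|n ih]; first by rewrite oppr0 expr0z mul1r.
  rewrite /= mu_landen_up; last exact: (landen_itv _ n%:Z).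
  by rewrite ih -!exprnN exprS invfM mulrC mulrA.
have mu_down s : 0 < s < 1 -> mu (landen_down s) = 2 * mu s.
  move=> s01; rewrite -[in RHS](landen_downK _ s01) mu_landen_up.
    by rewrite mulrC divfK.
  exact: landen_down_itv.
rewrite NegzE opprK.
elim: n => [|n ih]; first by rewrite /= mu_down.
rewrite /= mu_down; last exact: (landen_itv _ (Negz n)).
by rewrite [mu _]ih -!exprnP mulrA -exprS.
Qed.

End LandenTransformation.

(** * Surjectivity of the modulus function *)

Section MuSurjective.
Context {R : realType}.
Implicit Types (r y : R).

Lemma mu_gt0 r : 0 < r < 1 -> 0 < mu r.
Proof.
move=> /andP[r0 r1].
have r'01 : 0 <= Num.sqrt (1 - r ^+ 2) < 1.
  by rewrite sqrtr_ge0 -[ltRHS]sqrtr1 ltr_sqrt//; nra.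
by rewrite !mulr_gt0 ?pi_gt0 ?invr_gt0 ?ellipticK_gt0// r1 ltW.
Qed.

Lemma continuous_mu r : 0 < r < 1 -> {for r, continuous (@mu R)}.
Proof.
move=> r01; have /andP[r0 r1] := r01.
have r'01 : 0 < Num.sqrt (1 - r ^+ 2) < 1.
  by rewrite sqrtr_gt0 -[X in _ && (_ < X)]sqrtr1 ltr_sqrt//; nra.
have r'_cont : {for r, continuous (fun s : R => Num.sqrt (1 - s ^+ 2))}.
  apply: (@cvg_comp _ _ _ _ Num.sqrt); last exact: sqrt_continuous.
  by apply: cvgB; [exact: cvg_cst|exact: exprn_continuous].
apply: cvgM; first exact: cvg_cst.
apply: cvgM.
  apply: (@cvg_comp _ _ _ _ ellipticK); first exact: r'_cont.
  exact: continuous_ellipticK.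
apply: cvgV; last exact: continuous_ellipticK.
by rewrite gt_eqF// ellipticK_gt0// r1 ltW.
Qed.

Lemma mu_surj y : 0 < y -> exists2 r, 0 < r < 1 & mu r = y.
Proof.
move=> y0; pose h : R := 2^-1.
have h01 : 0 < h < 1 by rewrite /h; lra.
have m0 : 0 < mu h by exact: mu_gt0.
(* Enough Landen steps down and up from h = 1/2 bring mu above and below y. *)
have pow2 (z : R) : exists n : nat, z < 2 ^+ n.
  exists (Num.truncn `|z|).+1.
  rewrite (le_lt_trans (ler_norm z))// (lt_le_trans (truncnS_gt _))//.
  by rewrite -natrX ler_nat ltnW// ltn_expl.
have [n yn] := pow2 (y / mu h).
have [m ym] := pow2 (mu h / y).
pose a := landen h (- n%:Z); pose b := landen h m%:Z.
have [a01 b01] : 0 < a < 1 /\ 0 < b < 1 by split; exact: landen_itv.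
have mua : y < mu a by rewrite mu_landen// opprK -exprnP -ltr_pdivrMr.
have mub : mu b < y.
  rewrite mu_landen// -exprnN mulrC ltr_pdivrMr ?exprn_gt0//.
  by rewrite mulrC -ltr_pdivrMr.
(* The intermediate value theorem is used on the interval between a and b,
   in whichever order they come. *)
have ivt (c d : R) : 0 < c < 1 -> 0 < d < 1 -> c <= d ->
    Num.min (mu c) (mu d) <= y <= Num.max (mu c) (mu d) ->
    exists2 r, 0 < r < 1 & mu r = y.
  move=> /andP[c0 _] /andP[_ d1] cd ycd.
  have in01 r : r \in `[c, d] -> 0 < r < 1.
    rewrite in_itv/= => /andP[cr rd].
    by rewrite (lt_le_trans c0)// (le_lt_trans rd).
  have mu_cont : {within `[c, d], continuous (@mu R)}.
    by apply: continuous_in_subspaceT => r /set_mem/in01; exact: continuous_mu.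
  by have [r /in01 r01 <-] := IVT cd mu_cont ycd; exists r.
have [ab|/ltW ba] := leP a b.
  by apply: (ivt a b) => //; rewrite ge_min le_max !(ltW mua, ltW mub) ?orbT.
by apply: (ivt b a) => //; rewrite ge_min le_max !(ltW mua, ltW mub) ?orbT.
Qed.

End MuSurjective.

(** * Inverse functions on the unit interval *)

Section Inv01.
Context {R : realType}.

(** A partial inverse selects some preimage wherever one exists, so that [mu]
    is inverted by its surjectivity alone. *)
Lemma inv01_surj (f : R -> R) (y : R) : (exists2 r, 0 < r < 1 & f r = y) ->
  0 < inv01 f y < 1 /\ f (inv01 f y) = y.
Proof.
move=> [r r01 fr]; rewrite -{}fr.
have f_im : f r \in f @` `]0, 1[.
  by rewrite inE; exists r => //=; rewrite in_itv.
split; last exact: pinvK.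
have := @surjpinv_image_sub _ _ (fun=> 0) _ _ f (@subset_refl _ (f @` `]0, 1[)).
move=> /(_ (inv01 f (f r))); rewrite /= in_itv; apply.
by exists (f r) => //; exact/set_mem.
Qed.

Lemma decreasing_homeo_inv (f : R -> R) (y : R) : decreasing_homeo f -> 0 < y ->
  0 < inv01 f y < 1 /\ f (inv01 f y) = y.
Proof.
move=> [[_ _ f_surj] _ _ _] y0; apply: inv01_surj.
have [|r /=] := f_surj y; first by rewrite /= in_itv/= y0.
by rewrite in_itv/= => r01 fr; exists r.
Qed.

Lemma decreasing_homeo_lt (f : R -> R) (r s : R) : decreasing_homeo f ->
  0 < r < 1 -> 0 < s < 1 -> f r < f s -> s < r.
Proof.
move=> [_ f_decr _ _] r01 s01 frs; rewrite ltNge le_eqVlt; apply/negP.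
move=> /predU1P[rs|rs]; first by move: frs; rewrite rs ltxx.
have := f_decr r s; rewrite !in_itv/= => /(_ r01 s01 rs).
by move=> /(lt_trans frs); rewrite ltxx.
Qed.

End Inv01.

(** * Comparison of the inverse functions *)

Theorem proposition3p4 (R : realType) (u v : R -> R)
  (hu : decreasing_homeo u) (hv : decreasing_homeo v)
  (huv : forall r : R, 0 < r < 1 -> u r < mu r < v r)
  (y : R) (hy : 0 < y) (p : int) :
  landen (inv01 u ((2 : R) ^ (- p) * y)) (- p) < inv01 mu y
    < landen (inv01 v ((2 : R) ^ (- p) * y)) (- p).
Proof.
have [x01 mux] := inv01_surj _ _ (mu_surj _ hy).
set x := inv01 mu y in x01 mux *.
set w := 2 ^ (- p) * y.
have w0 : 0 < w by rewrite mulr_gt0// exprz_gt0.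
have [a01 ua] := decreasing_homeo_inv _ _ hu w0.
have [b01 vb] := decreasing_homeo_inv _ _ hv w0.
set a := inv01 u w in a01 ua *; set b := inv01 v w in b01 vb *.
have z01 := landen_itv _ p x01.
have muz : mu (landen x p) = w by rewrite mu_landen// mux.
have /andP[uz vz] := huv _ z01.
have az : a < landen x p.
  by apply: (decreasing_homeo_lt _ _ _ hu) => //; rewrite ua -muz.
have zb : landen x p < b.
  by apply: (decreasing_homeo_lt _ _ _ hv) => //; rewrite vb -muz.
rewrite -[X in _ < X < _](landenK _ p x01).
case/andP: a01 => a0 _; case/andP: b01 => _ b1; case/andP: z01 => z0 z1.
by rewrite !landen_lt.
Qed.
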